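(* For all constants $b,\delta>0$ there exist $c_{b,\delta}>0$ and $n_0=n_0(b,\delta)$, and there is an absolute constant $C$, such that the following holds. Let $n\ge n_0$, let $X$ be a countable set and $\rho$ a cost function on $X$ with $\rho(x,y)\ge1+\delta$ whenever $x\ne y$ and with $\deg_b(\rho)<\infty$. Then for every integer $m$ with $n<m\le c_{b,\delta}\,\frac{n}{(\ln n)^2}\ln\deg_b(\rho)$, there exist $f:X^n\to\{0,1\}$ and a distribution $\mathcal D$ on $X$ with $$\mathrm{AdaptiveMax}_\rho(f\circ\Phi_{m\to n},\mathcal D)\ge1-\frac Cn\qquad\text{and}\qquad\mathrm{ObliviousMax}_\rho(f,\mathcal D)\le\frac Cn.$$ In particular, if $f\circ\Phi_{m\to n}$ under the adaptive adversary is to be $0.9$-equivalent to $f$ under the oblivious adversary for all such $f$, then $m\ge\tilde\Omega_{b,\delta}(n\ln\deg_b(\rho))$.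
   Context: A cost function on $X$ is $\rho:X\times X\to\mathbb R_{\ge0}\cup\{\infty\}$ with $\rho(x,x)=0$. The $b$-bounded degree is $\deg_b(\rho)=\sup_{x\in X}\#\{y\in X:\rho(x,y)\le b\}$. For $S\in X^m$, $\mathcal C_\rho(S)=\{S'\in X^m:\frac1m\sum_i\rho(S_i,S'_i)\le1\}$; $\mathcal C_\rho(\mathcal D)$ is the set of distributions $\mathcal D'$ admitting a coupling of $x\sim\mathcal D$, $x'\sim\mathcal D'$ with $\mathbb E[\rho(x,x')]\le1$. $\Phi_{m\to n}$ picks $n$ distinct uniformly random indices of $[m]$ and outputs the corresponding entries. $\mathrm{AdaptiveMax}_\rho(g,\mathcal D)=\mathbb E_{S\sim\mathcal D^m}[\sup_{S'\in\mathcal C_\rho(S)}\mathbb E[g(S')]]$ for (randomized) $g:X^m\to\{0,1\}$, and $\mathrm{ObliviousMax}_\rho(f,\mathcal D)=\sup_{\mathcal D'\in\mathcal C_\rho(\mathcal D)}\mathbb E_{S'\sim(\mathcal D')^n}[f(S')]$ for $f:X^n\to\{0,1\}$. *)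

(* Defs.v *)
From HB Require Import structures.
From mathcomp Require Import all_boot all_order all_algebra.
From mathcomp Require Import all_classical all_reals.
From mathcomp Require Import ereal esum exp.
Set Implicit Arguments. Unset Strict Implicit. Unset Printing Implicit Defensive.
Import Order.TTheory GRing.Theory Num.Theory.
Local Open Scope classical_set_scope.
Local Open Scope ring_scope.
Local Open Scope ereal_scope.

Section Defs.
Variables (R : realType) (X : choiceType).

Definition is_cost (rho : X -> X -> \bar R) : Prop :=
  (forall x y, 0 <= rho x y) /\ (forall x, rho x x = 0).

Definition has_b_nbrs (rho : X -> X -> \bar R) (b : R) (x : X) (k : nat) : Prop :=
  exists s : seq X, [/\ uniq s, size s = k & forall y, y \in s -> rho x y <= b%:E].

Definition degb (rho : X -> X -> \bar R) (b : R) : \bar R :=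
  ereal_sup [set (k%:R)%:E | k in [set k : nat | exists x, has_b_nbrs rho b x k]].

Definition is_pmf (T : choiceType) (p : T -> R) : Prop :=
  (forall t, (0 <= p t)%R) /\ \esum_(t in [set: T]) (p t)%:E = 1.

Definition prodpmf (p : X -> R) (k : nat) (S : k.-tuple X) : R :=
  (\prod_(i < k) p (tnth S i))%R.

Definition Eprod (p : X -> R) (k : nat) (h : k.-tuple X -> \bar R) : \bar R :=
  \esum_(S in [set: k.-tuple X]) ((prodpmf p S)%:E * h S).

Definition Crho_seq (rho : X -> X -> \bar R) (m : nat) (S : m.-tuple X) : set (m.-tuple X) :=
  [set S' | ((m%:R)^-1)%:E * (\sum_(i < m) rho (tnth S i) (tnth S' i)) <= 1].

(* Phi_{m->n}: n distinct uniformly random indices of [m] (in the order drawn,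
   i.e. a uniformly random injection 'I_n -> 'I_m); E[f(Phi(S))] *)
Definition subsample (n m : nat) (phi : {ffun 'I_n -> 'I_m}) (S : m.-tuple X) : n.-tuple X :=
  [tuple tnth S (phi i) | i < n].

Definition Ef_Phi (n m : nat) (f : n.-tuple X -> bool) (S : m.-tuple X) : R :=
  ((#|[set phi : {ffun 'I_n -> 'I_m} | injectiveb phi]|%:R)^-1 *
   \sum_(phi in [set phi : {ffun 'I_n -> 'I_m} | injectiveb phi])
      (f (subsample phi S))%:R)%R.

Definition AdaptiveMax_sub (rho : X -> X -> \bar R) (n m : nat)
    (f : n.-tuple X -> bool) (p : X -> R) : \bar R :=
  Eprod p (fun S : m.-tuple X =>
    ereal_sup [set (Ef_Phi f S')%:E | S' in Crho_seq rho S]).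

Definition is_coupling (p q : X -> R) (pi : X * X -> R) : Prop :=
  is_pmf pi /\
  (forall x, \esum_(y in [set: X]) (pi (x, y))%:E = (p x)%:E) /\
  (forall y, \esum_(x in [set: X]) (pi (x, y))%:E = (q y)%:E).

Definition Crho_dist (rho : X -> X -> \bar R) (p : X -> R) : set (X -> R) :=
  [set q | is_pmf q /\ exists pi, is_coupling p q pi /\
      \esum_(xy in [set: X * X]) ((pi xy)%:E * rho xy.1 xy.2) <= 1].

Definition ObliviousMax (rho : X -> X -> \bar R) (n : nat)
    (f : n.-tuple X -> bool) (p : X -> R) : \bar R :=
  ereal_sup [set Eprod q (fun S : n.-tuple X => ((f S)%:R)%:E) | q in Crho_dist rho p].

End Defs.

(* Main.v *)
(** The neighbourhood of a point of maximal degree contains a grid of "cells"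
    [(j, a)] and, for every row [j] and every subset [B] of that row, a
    "witness" [(j, B)].  The source distribution puts a small mass [p] on the
    centre and is uniform on the cells; [test] accepts when the sample contains
    one witness per row, none of the witnessed cells, and the witnesses cover
    almost the whole grid.  The adaptive adversary sees which cells were not
    drawn and turns copies of the centre into the witnesses of the unseen part
    of each row.  An oblivious adversary must leave mass on most cells, hence
    in some row the witnessed cells have mass at least [tau] of order
    [ln n / n], and the remaining draws avoid such a set with probability
    polynomially small in [n].  Witnesses being subsets, about [2 ^ s]
    neighbours suffice for rows of length [s], so that [m] may be of order
    [n * ln (degree) / ln n]. *)
Require Import Defs.
From HB Require Import structures.
From mathcomp Require Import all_boot all_order all_algebra.
From mathcomp Require Import all_classical all_reals.
From mathcomp Require Import ereal esum sequences exp.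
From mathcomp Require Import ring lra zify.
Set Implicit Arguments. Unset Strict Implicit. Unset Printing Implicit Defensive.
Import Order.TTheory GRing.Theory Num.Theory.
Local Open Scope classical_set_scope.
Local Open Scope ring_scope.

(** * Sums over arbitrary types and expectations under product distributions *)

Lemma esumZl (R : realType) (T : choiceType) (c : R) (a : T -> \bar R) :
  0 <= c -> (forall x, (0 <= a x)%E) ->
  (\esum_(x in [set: T]) (c%:E * a x) = c%:E * \esum_(x in [set: T]) a x)%E.
Proof.
move=> c0 a0; rewrite /esum -ereal_supZl//; last first.
  by apply/set0P; exists (\sum_(x \in set0) a x)%E; exists set0 => //; exact: fsets_set0.
congr ereal_sup; rewrite image_comp; apply: eq_imagel => A _ /=.
by rewrite -ge0_mule_fsumr.
Qed.

Lemma esum_ge1 (R : realType) (T : choiceType) (a : T -> \bar R) (t : T) :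
  (forall x, (0 <= a x)%E) -> (a t <= \esum_(x in [set: T]) a x)%E.
Proof.
move=> a0; apply: esum_ge; exists [set t]; last by rewrite fsbig_set1.
by split => //; exact: finite_set1.
Qed.

Lemma esum_delta (R : realType) (T : choiceType) (c : R) (t : T) : 0 <= c ->
  (\esum_(x in [set: T]) (c * (x == t)%:R)%:E = c%:E)%E.
Proof.
move=> c0; rewrite (esumID [set t]); last first.
  by move=> x _; rewrite lee_fin mulr_ge0.
rewrite setTI esum_set1 ?eqxx ?mulr1 ?lee_fin// esum1 ?adde0//.
by move=> x [_ /= /eqP /negbTE ->]; rewrite mulr0.
Qed.

(** Fubini, by induction on [k] along the bijection between [X * k.-tuple X] and [k.+1.-tuple X].
    Factors depend on the position because some positions are singled out later. *)
Lemma esum_prod_tuple (R : realType) (X : choiceType) (k : nat)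
    (h : 'I_k -> X -> R) (H : 'I_k -> R) :
  (forall i x, 0 <= h i x) ->
  (forall i, \esum_(x in [set: X]) (h i x)%:E = (H i)%:E)%E ->
  (\esum_(S in [set: k.-tuple X]) (\prod_(i < k) h i (tnth S i))%:E
    = (\prod_(i < k) H i)%:E)%E.
Proof.
elim: k h H => [|k IH] h H h0 hH.
  rewrite big_ord0 (_ : [set: 0.-tuple X] = [set [tuple]]); last first.
    by apply/seteqP; split => // x _ /=; rewrite tuple0.
  by rewrite esum_set1 big_ord0// lee_fin.
pose e (xt : X * k.-tuple X) : k.+1.-tuple X := cons_tuple xt.1 xt.2.
have bije : set_bij ([set: X] `*`` (fun=> [set: k.-tuple X])) [set: k.+1.-tuple X] e.
  split => //.
  - move=> [x t] [y u] _ _ /(congr1 (fun z : k.+1.-tuple X => tval z)) /= [-> tu].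
    by congr pair; apply: val_inj.
  - by move=> t _ /=; exists (thead t, behead_tuple t) => //; rewrite /e /=;
      apply: val_inj => /=; case/tupleP: t => x t /=; rewrite theadE.
rewrite (@reindex_esum _ _ _ _ _ _ _ bije) /e.
under eq_esum => xt _.
  rewrite big_ord_recl tnth0.
  under eq_bigr do rewrite tnthS.
  over.
rewrite -(@esum_esum _ _ _ [set: X] (fun=> [set: k.-tuple X])
  (fun x t => (h ord0 x * \prod_(i < k) h (lift ord0 i) (tnth t i))%:E))/=; last first.
  by move=> x t _ _; rewrite lee_fin mulr_ge0// prodr_ge0.
under eq_esum => x _.
  under eq_esum do rewrite EFinM.
  rewrite esumZl//; last by move=> t; rewrite lee_fin prodr_ge0.
  rewrite (IH (fun i => h (lift ord0 i)) (fun i => H (lift ord0 i)))//.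
  rewrite muleC.
  over.
have H0 i : 0 <= H i.
  by rewrite -lee_fin -hH esum_ge0// => x _; rewrite lee_fin.
rewrite esumZl ?prodr_ge0//; last by move=> x; rewrite lee_fin.
by rewrite hH big_ord_recl -EFinM mulrC.
Qed.

(** Independence of the draws. The expectations needed below are all reduced to those of such
    products. *)
Lemma Eprod_prod (R : realType) (X : choiceType) (p : X -> R) (k : nat)
    (g : 'I_k -> X -> R) (G : 'I_k -> R) :
  (forall x, 0 <= p x) -> (forall i x, 0 <= g i x) ->
  (forall i, \esum_(x in [set: X]) (p x * g i x)%:E = (G i)%:E)%E ->
  (Eprod p (fun S : k.-tuple X => (\prod_(i < k) g i (tnth S i))%:E)
    = (\prod_(i < k) G i)%:E)%E.
Proof.
move=> p0 g0 gG.
rewrite -(@esum_prod_tuple R X k (fun i x => p x * g i x))//; last first.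
  by move=> i x; rewrite mulr_ge0.
by apply: eq_esum => S _; rewrite /prodpmf -EFinM -big_split.
Qed.

Lemma Eprod1 (R : realType) (X : choiceType) (p : X -> R) (k : nat) :
  is_pmf p -> Eprod p (fun S : k.-tuple X => 1%E) = 1%E.
Proof.
move=> [p0 p1]; transitivity (Eprod p (fun S : k.-tuple X => (\prod_(i < k) (1:R))%:E)).
  by apply: eq_esum => S _; rewrite big1_eq.
rewrite (@Eprod_prod _ _ _ _ (fun _ _ => 1) (fun=> 1))// ?big1_eq// => i.
by under eq_esum do rewrite mulr1.
Qed.

Lemma prodpmf_ge0 (R : realType) (X : choiceType) (p : X -> R) (k : nat) (S : k.-tuple X) :
  (forall x, 0 <= p x) -> 0 <= prodpmf p S.
Proof. by move=> p0; apply: prodr_ge0. Qed.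

Lemma le_Eprod (R : realType) (X : choiceType) (p : X -> R) (k : nat)
    (h1 h2 : k.-tuple X -> \bar R) :
  (forall x, 0 <= p x) -> (forall S, (h1 S <= h2 S)%E) ->
  (Eprod p h1 <= Eprod p h2)%E.
Proof.
move=> p0 h12; apply: le_esum => S _; apply: lee_wpmul2l => //.
by rewrite lee_fin prodpmf_ge0.
Qed.

Lemma EprodD (R : realType) (X : choiceType) (p : X -> R) (k : nat)
    (h1 h2 : k.-tuple X -> \bar R) : (forall x, 0 <= p x) ->
  (forall S, (0 <= h1 S)%E) -> (forall S, (0 <= h2 S)%E) ->
  (Eprod p (fun S => h1 S + h2 S) = Eprod p h1 + Eprod p h2)%E.
Proof.
move=> p0 h1p h2p; have q0 (S : k.-tuple X) : (0 <= (prodpmf p S)%:E)%E.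
  by rewrite lee_fin prodpmf_ge0.
rewrite /Eprod -esumD; [|by move=> S _; rewrite mule_ge0..].
by apply: eq_esum => S _; rewrite ge0_muleDr.
Qed.

Lemma Eprod_sum (R : realType) (X : choiceType) (p : X -> R) (k : nat)
    (I : choiceType) (r : seq I) (P : pred I) (h : I -> k.-tuple X -> R) :
  (forall x, 0 <= p x) -> (forall i S, 0 <= h i S) ->
  (Eprod p (fun S => (\sum_(i <- r | P i) h i S)%:E) =
   \sum_(i <- r | P i) Eprod p (fun S => (h i S)%:E))%E.
Proof.
move=> p0 h0; rewrite /Eprod -esum_sum; last first.
  by move=> S i _ _; rewrite -EFinM lee_fin mulr_ge0// prodpmf_ge0.
apply: eq_esum => S _; rewrite -EFinM mulr_sumr -sumEFin.
by apply: eq_bigr => i _; rewrite EFinM.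
Qed.

Lemma EprodZl (R : realType) (X : choiceType) (p : X -> R) (k : nat) (c : R)
    (h : k.-tuple X -> R) :
  (forall x, 0 <= p x) -> 0 <= c -> (forall S, 0 <= h S) ->
  (Eprod p (fun S => (c * h S)%:E) = c%:E * Eprod p (fun S => (h S)%:E))%E.
Proof.
move=> p0 c0 h0; rewrite /Eprod -esumZl//; last first.
  by move=> S; rewrite -EFinM lee_fin mulr_ge0// prodpmf_ge0.
by apply: eq_esum => S _; rewrite -!EFinM mulrCA.
Qed.

(** * Injections of indices and sums over labellings *)

Lemma prod_inj_reindex (R : comPzRingType) (n m : nat) (phi : {ffun 'I_n -> 'I_m})
    (F : 'I_m -> R) : injective phi ->
  \prod_(t < n) F (phi t) = \prod_(i < m) (if i \in codom phi then F i else 1).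
Proof.
move=> phi_inj; rewrite -big_mkcond/=.
rewrite (eq_bigl (mem (phi @: [set: 'I_n]%SET))); last first.
  by move=> i; apply/idP/idP => [/codomP[t ->]|/imsetP[t _ ->]];
    [exact: imset_f|exact: codom_f].
rewrite big_imset/=; last by move=> x y _ _; exact: phi_inj.
by apply: eq_bigl => t; rewrite !inE.
Qed.

(** Each of the [m - n] positions off the image of [phi] has a free label and contributes a factor
    [r]; on the image the sum over labellings factorizes. *)
Lemma sum_ffun_prod_inj (R : comPzRingType) (n m r : nat)
    (phi : {ffun 'I_n -> 'I_m}) (F : 'I_m -> 'I_r -> R) :
  injective phi ->
  \sum_(lab : {ffun 'I_m -> 'I_r}) \prod_(t < n) F (phi t) (lab (phi t))
  = r%:R ^+ (m - n) * \prod_(t < n) \sum_(j < r) F (phi t) j.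
Proof.
move=> phi_inj.
under eq_bigr => lab _.
  rewrite (@prod_inj_reindex _ _ _ _ (fun i => F i (lab i)))//.
  over.
rewrite -(bigA_distr_bigA (fun i j => if i \in codom phi then F i j else 1)).
rewrite (bigID (mem (codom phi)))/= mulrC; congr (_ * _).
  rewrite (eq_bigr (fun=> r%:R)); last first.
    by move=> i /negbTE ->; rewrite sumr_const card_ord.
  rewrite prodr_const; congr (_ ^+ _).
  have := cardC (mem (codom phi)); rewrite card_ord card_codom// card_ord => cardE.
  by rewrite -[in RHS]cardE addKn.
rewrite (@prod_inj_reindex _ _ _ _ (fun i => \sum_(j < r) F i j))//.
by rewrite -big_mkcond/=; apply: eq_bigr => i ->.
Qed.

Lemma Ef_PhiE (R : realType) (X : choiceType) (n m : nat)
    (f : n.-tuple X -> bool) (S : m.-tuple X) :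
  Ef_Phi R f S = (#|[pred phi : {ffun 'I_n -> 'I_m} | injectiveb phi]|%:R)^-1 *
    \sum_(phi : {ffun 'I_n -> 'I_m} | injectiveb phi) (f (subsample phi S))%:R.
Proof.
rewrite /Ef_Phi; congr (_^-1 * _).
  by congr (_%:R); apply: eq_card => phi; apply/idP/idP => [/set_mem//|h]; exact: mem_set.
by apply: eq_bigl => phi; apply/idP/idP => [/set_mem//|h]; exact: mem_set.
Qed.

Lemma card_inj_gt0 (n m : nat) : (n <= m)%N ->
  (0 < #|[pred phi : {ffun 'I_n -> 'I_m} | injectiveb phi]|)%N.
Proof.
move=> nm; have := card_inj_ffuns 'I_n 'I_m; rewrite !card_ord cardsE => ->.
by rewrite ffact_gt0.
Qed.

(** * The grid, the test and the source distribution *)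

Section Construction.
Variables (R : realType) (X : choiceType) (r s : nat).
Variable e : option ('I_r * 'I_s + 'I_r * {set 'I_s}) -> X.

(* [witness j B] claims that the cells [(j, a)], [a \in B], do not occur in the
   sample. *)
Definition center := e None.
Definition cell (w : 'I_r * 'I_s) := e (Some (inl w)).
Definition witness (j : 'I_r) (B : {set 'I_s}) := e (Some (inr (j, B))).

Definition row (A : {set 'I_r * 'I_s}) (j : 'I_r) : {set 'I_s} :=
  [set a | (j, a) \in A]%SET.

(** A single set [A] of cells carries the claims of all rows: its rows are the sets named by the
    witnesses. Later [K] is [r * s - m], a number of cells that [m] draws always miss. *)
Definition test (K n : nat) (S : n.-tuple X) : bool :=
  [exists A : {set 'I_r * 'I_s}, [&& (K <= #|A|)%N,
     [forall j, witness j (row A j) \in S] &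
     [forall w, (w \in A) ==> (cell w \notin S)]]].

(** Written as a sum of point masses, so that integrating against it needs no injectivity of [e]. *)
Definition source (p : R) (x : X) : R :=
  p * (x == center)%:R + \sum_w (1 - p) / (r * s)%:R * (x == cell w)%:R.

Lemma source_ge0 p x : 0 <= p <= 1 -> 0 <= source p x.
Proof.
move=> /andP[p0 p1]; rewrite addr_ge0 ?mulr_ge0// sumr_ge0// => w _.
by rewrite mulr_ge0// divr_ge0// subr_ge0.
Qed.

Lemma esum_source p (g : X -> R) : 0 <= p <= 1 -> (forall x, 0 <= g x) ->
  (\esum_(x in [set: X]) (source p x * g x)%:E =
   (p * g center + \sum_w (1 - p) / (r * s)%:R * g (cell w))%:E)%E.
Proof.
move=> /andP[p0 p1] g0.
have c0 : 0 <= (1 - p) / (r * s)%:R by rewrite divr_ge0// subr_ge0.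
under eq_esum => x _.
  rewrite mulrDl mulr_suml (_ : p * _ * _ = p * g center * (x == center)%:R); last first.
    by case: eqP => [->|_]; rewrite ?(mulr0, mul0r, mulr1).
  under eq_bigr => w _.
    rewrite (_ : _ * _ * _ = (1 - p) / (r * s)%:R * g (cell w) * (x == cell w)%:R); last first.
      by case: eqP => [->|_]; rewrite ?(mulr0, mul0r, mulr1).
    over.
  rewrite EFinD -sumEFin.
  over.
rewrite esumD; last 2 first.
- by move=> x _; rewrite lee_fin !mulr_ge0.
- by move=> x _; rewrite sume_ge0// => w _; rewrite lee_fin mulr_ge0// mulr_ge0.
rewrite esum_delta ?mulr_ge0// esum_sum; last first.
  by move=> x w _ _; rewrite lee_fin mulr_ge0// mulr_ge0.
rewrite EFinD -sumEFin; congr (_ + _)%E; apply: eq_bigr => w _.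
by rewrite esum_delta// mulr_ge0.
Qed.

Lemma source_pmf p : 0 <= p <= 1 -> (0 < r * s)%N -> is_pmf (source p).
Proof.
move=> p01 rs0; split; first by move=> x; exact: source_ge0.
under eq_esum do rewrite -[source p _]mulr1.
rewrite (@esum_source p (fun=> 1))//; congr (_%:E).
rewrite sumr_const card_prod !card_ord !mulr1 -[X in _ + X]mulr_natr.
by rewrite divfK ?subrKC// pnatr_eq0 -lt0n.
Qed.

Hypothesis e_inj : injective e.

Lemma cell_inj : injective cell.
Proof. by move=> w w' /e_inj[]. Qed.

(** * The adaptive adversary *)

Definition unseen (m : nat) (S : m.-tuple X) : {set 'I_r * 'I_s} :=
  [set w | cell w \notin S]%SET.

Lemma card_unseen m (S : m.-tuple X) : (r * s - m <= #|unseen S|)%N.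
Proof.
have := cardsC (unseen S); rewrite card_prod !card_ord => <-.
suff : (#|~: unseen S| <= m)%N by lia.
rewrite cardE -(size_map cell) -[leqRHS](size_tuple S) uniq_leq_size//.
  by rewrite map_inj_uniq ?enum_uniq//; exact: cell_inj.
by move=> _ /mapP[w + ->]; rewrite mem_enum !inE negbK.
Qed.

Definition corrupt (m : nat) (lab : {ffun 'I_m -> 'I_r}) (S : m.-tuple X) : m.-tuple X :=
  [tuple if tnth S i == center then witness (lab i) (row (unseen S) (lab i))
         else tnth S i | i < m].

(** Only copies of the centre are changed, each at cost at most [B]. *)
Lemma corrupt_cost (rho : X -> X -> \bar R) (B m : nat)
    (lab : {ffun 'I_m -> 'I_r}) (S : m.-tuple X) :
  (forall x, rho x x = 0%E) -> (forall w, (rho center (e w) <= B%:R%:E)%E) ->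
  (0 < m)%N ->
  ((\sum_(i < m) (tnth S i == center)) * B <= m)%N -> Crho_seq rho S (corrupt lab S).
Proof.
move=> rho0 rhoB m0 hm; rewrite /Crho_seq/=.
rewrite -(@lee_pmul2l _ m%:R%:E) ?lte_fin ?ltr0n// muleA -EFinM divff ?pnatr_eq0 -?lt0n//.
rewrite mul1e mule1; apply: (@le_trans _ _ (\sum_(i < m) ((tnth S i == center) * B)%:R%:E)%E).
  apply: lee_sum => i _; rewrite tnth_mktuple; case: eqP => [->|_]; first by rewrite mul1n; exact: rhoB.
  by rewrite rho0.
by rewrite sumEFin lee_fin -natr_sum ler_nat -big_distrl.
Qed.

(** Each product is the indicator that no drawn centre carries the label [j]. If every row is
    served, [unseen S] passes the test, because corruption adds only witnesses and these are never
    cells. Otherwise some product is 1 and the left side is at most 0. *)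
Lemma test_corrupt (n m : nat) (phi : {ffun 'I_n -> 'I_m})
    (lab : {ffun 'I_m -> 'I_r}) (S : m.-tuple X) :
  1 - \sum_(j < r) \prod_(t < n)
        (1 - ((tnth S (phi t) == center) && (lab (phi t) == j))%:R)
    <= (test (r * s - m) (subsample phi (corrupt lab S)))%:R :> R.
Proof.
have P0 (j : 'I_r) : 0 <= \prod_(t < n)
   (1 - ((tnth S (phi t) == center) && (lab (phi t) == j))%:R) :> R.
  by apply: prodr_ge0 => t _; rewrite subr_ge0 lern1 leq_b1.
have [hit|] := boolP [forall j : 'I_r, [exists t : 'I_n,
    (tnth S (phi t) == center) && (lab (phi t) == j)]].
  suff -> : test (r * s - m) (subsample phi (corrupt lab S)).
    by rewrite lerBlDr lerDl sumr_ge0.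
  apply/existsP; exists (unseen S); apply/and3P; split; first exact: card_unseen.
    apply/forallP => j; have /existsP[t /andP[St /eqP labt]] := forallP hit j.
    by apply/tnthP; exists t; rewrite !tnth_mktuple St labt.
  apply/forallP => w; apply/implyP; rewrite inE => wS.
  apply/negP => /tnthP[t]; rewrite !tnth_mktuple; case: ifPn => [_ /e_inj//|_ wSt].
  by move/negP: wS; apply; rewrite wSt mem_tnth.
rewrite negb_forall => /existsP[j]; rewrite negb_exists => /forallP miss.
apply: (@le_trans _ _ 0); last by [].
rewrite subr_le0 (bigD1 j)//= big1 ?lerDl ?sumr_ge0// => t _.
by rewrite (negbTE (miss t)) subr0.
Qed.


(* Uniformly random labels on the corrupted positions make the subsample hit
   every row independently of the injection; the supremum over the adversary's
   choices dominates the average over the labels. *)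
Lemma sup_test_ge (rho : X -> X -> \bar R) (B n m : nat) (S : m.-tuple X) :
  (forall x, rho x x = 0%E) -> (forall w, (rho center (e w) <= B%:R%:E)%E) ->
  (0 < r)%N -> (0 < m)%N -> (n <= m)%N ->
  ((\sum_(i < m) (tnth S i == center)) * B <= m)%N ->
  ((1 - (#|[pred phi : {ffun 'I_n -> 'I_m} | injectiveb phi]|%:R)^-1 *
     \sum_(phi : {ffun 'I_n -> 'I_m} | injectiveb phi)
       r%:R * \prod_(t < n) (1 - (tnth S (phi t) == center)%:R / r%:R))%:E <=
   ereal_sup [set (Ef_Phi R (@test (r * s - m) n) S')%:E | S' in Crho_seq rho S])%E.
Proof.
move=> rho0 rhoB r0 m0 nm budget.
set V := ereal_sup _.
set Phi := #|_|.
have Phi0 : (0 < Phi%:R :> R) by rewrite ltr0n card_inj_gt0.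
have hlab lab : ((Ef_Phi R (@test (r * s - m) n) (corrupt lab S))%:E <= V)%E.
  by apply: ereal_sup_ubound; exists (corrupt lab S) => //; exact: corrupt_cost budget.
pose L : R := #|{ffun 'I_m -> 'I_r}|%:R.
have LE : L = r%:R ^+ m by rewrite /L card_ffun !card_ord natrX.
have r0' : (0 < r%:R :> R) by rewrite ltr0n.
have L0 : 0 < L by rewrite LE exprn_gt0.
suff avg : L * (1 - Phi%:R^-1 *
     \sum_(phi : {ffun 'I_n -> 'I_m} | injectiveb phi)
       r%:R * \prod_(t < n) (1 - (tnth S (phi t) == center)%:R / r%:R)) <=
   \sum_(lab : {ffun 'I_m -> 'I_r}) Ef_Phi R (@test (r * s - m) n) (corrupt lab S).
  rewrite leNgt; apply/negP => Vlt.
  have [x Vx] : exists2 x : R, V = x%:E & True.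
    have := hlab [ffun=> Ordinal r0]; case: (V) Vlt => [x|//|//] _ _.
    by exists x.
  rewrite Vx lte_fin in Vlt; move=> _.
  have : \sum_(lab : {ffun 'I_m -> 'I_r}) Ef_Phi R (@test (r * s - m) n) (corrupt lab S)
      <= L * x.
    rewrite /L mulr_natl -sumr_const; apply: ler_sum => lab _.
    by have := hlab lab; rewrite Vx lee_fin.
  move/(le_trans avg); rewrite ler_pM2l// => /(lt_le_trans Vlt).
  by rewrite ltxx.
under [leRHS]eq_bigr do rewrite Ef_PhiE.
rewrite -[leRHS]mulr_sumr [X in _ <= _ * X]exchange_big/= -(ler_pM2l Phi0) mulVKf ?gt_eqF//.
rewrite mulrCA mulrBr mulr1 mulVKf ?gt_eqF// mulrBr.
rewrite lerBlDr.
have -> : L * Phi%:R = \sum_(phi : {ffun 'I_n -> 'I_m} | injectiveb phi) L.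
  by rewrite sumr_const mulr_natr.
rewrite mulr_sumr -big_split/=; apply: ler_sum => phi /injectiveP phi_inj.
rewrite -lerBlDr.
apply: (@le_trans _ _ (\sum_(lab : {ffun 'I_m -> 'I_r}) (1 - \sum_(j < r) \prod_(t < n)
        (1 - ((tnth S (phi t) == center) && (lab (phi t) == j))%:R)))); last first.
  by apply: ler_sum => lab _; exact: test_corrupt.
rewrite big_split/= sumr_const -/L lerD2l sumrN lerN2 exchange_big/=.
rewrite mulrCA (_ : r%:R * (L * _) = \sum_(j < r) L * \prod_(t < n)
   (1 - (tnth S (phi t) == center)%:R / r%:R)); last first.
  by rewrite sumr_const card_ord mulr_natl.
apply: ler_sum => j _.
rewrite (@sum_ffun_prod_inj _ _ _ _ _ (fun i k =>
  1 - ((tnth S i == center) && (k == j))%:R))//.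
(* The remaining [n] factors [r] go one to each drawn index. With [c] the indicator of the centre
   there, [r * (1 - c / r) = r - c] is the sum over labels, as exactly one label equals [j]. *)
have -> : L = r%:R ^+ (m - n) * r%:R ^+ n by rewrite -exprD subnK.
rewrite -mulrA; apply: ler_wpM2l; first by rewrite exprn_ge0.
rewrite -[X in _ ^+ X * _](card_ord n) -prodr_const -big_split/=.
rewrite le_eqVlt; apply/orP; left; apply/eqP; apply: eq_bigr => t _.
rewrite big_split/= sumr_const card_ord sumrN mulrBr mulr1 mulrCA divff ?gt_eqF// mulr1.
congr (_ - _).
rewrite (bigD1 j)//= eqxx andbT big1 ?addr0// => k /negbTE ->.
by rewrite andbF.
Qed.

Lemma cell_neq_center w : (cell w == center) = false.
Proof. by apply/eqP => /e_inj. Qed.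

Lemma esum_source_center p (a c : R) : 0 <= p <= 1 -> 0 <= a -> 0 <= c ->
  (0 < r * s)%N ->
  (\esum_(x in [set: X]) (source p x * (if x == center then a else c))%:E =
   (p * a + (1 - p) * c)%:E)%E.
Proof.
move=> p01 a0 c0 rs0.
rewrite (esum_source p01 (g := fun x => if x == center then a else c)); last first.
  by move=> x; case: ifP.
rewrite eqxx; congr (_ + _)%:E; under eq_bigr do rewrite cell_neq_center.
rewrite sumr_const card_prod !card_ord -[LHS]mulr_natr mulrAC divfK//.
by rewrite pnatr_eq0 -lt0n.
Qed.

(* The two error terms bound the probability that the budget is exceeded
   (exponential Markov inequality) and that some row is missed. *)
Lemma AdaptiveMax_test_ge (rho : X -> X -> \bar R) (p : R) (B n m : nat) :
  is_cost rho -> (forall w, (rho center (e w) <= B%:R%:E)%E) ->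
  0 <= p <= 1 -> p * 2 ^+ B <= 2^-1 ->
  (0 < r * s)%N -> (0 < m)%N -> (n <= m)%N ->
  ((1 - ((3 / 4) ^+ m + r%:R * (1 - p / r%:R) ^+ n))%:E <=
    AdaptiveMax_sub rho m (@test (r * s - m) n) (source p))%E.
Proof.
move=> [rho_ge0 rho0] rhoB p01 pB rs0 m0 nm.
have q0 x : 0 <= source p x by exact: source_ge0.
have r0 : (0 < r)%N by move: rs0; rewrite muln_gt0 => /andP[].
have r0' : (0 < r%:R :> R) by rewrite ltr0n.
have /andP[p0 p1] := p01.
(* With [c] centres in [S], [heavy S] is [2 ^ (c B - m)], hence at least 1 once the budget is
   exceeded. *)
pose heavy (S : m.-tuple X) : R :=
  \prod_(i < m) (if tnth S i == center then 2 ^+ B / 2 else 2^-1).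
pose cov (phi : {ffun 'I_n -> 'I_m}) (S : m.-tuple X) : R :=
  \prod_(t < n) (1 - (tnth S (phi t) == center)%:R / r%:R).
set Phi := #|[pred phi : {ffun 'I_n -> 'I_m} | injectiveb phi]|.
pose missed (S : m.-tuple X) : R := Phi%:R^-1 *
  \sum_(phi : {ffun 'I_n -> 'I_m} | injectiveb phi) r%:R * cov phi S.
have Phi0 : (0 < Phi%:R :> R) by rewrite ltr0n card_inj_gt0.
have factor_ge0 (b : bool) : 0 <= 1 - b%:R / r%:R :> R.
  by rewrite subr_ge0 ler_pdivrMr// mul1r ler_nat; case: b.
have heavy0 S : 0 <= heavy S.
  by apply: prodr_ge0 => i _; case: ifP => _; rewrite ?divr_ge0 ?exprn_ge0 ?invr_ge0.
have cov0 phi S : 0 <= cov phi S by apply: prodr_ge0 => t _; exact: factor_ge0.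
have missed0 S : 0 <= missed S.
  by rewrite mulr_ge0 ?invr_ge0 ?ler0n// sumr_ge0// => phi _; rewrite mulr_ge0.
pose V (S : m.-tuple X) := ereal_sup
  [set (Ef_Phi R (@test (r * s - m) n) S')%:E | S' in Crho_seq rho S].
have V0 S : (0 <= V S)%E.
  apply: (@le_trans _ _ (Ef_Phi R (@test (r * s - m) n) S)%:E).
    by rewrite lee_fin Ef_PhiE mulr_ge0 ?invr_ge0 ?ler0n// sumr_ge0.
  apply: ereal_sup_ubound; exists S => //; rewrite /Crho_seq/=.
  by rewrite big1 ?mule0.
have pointwise S : (1 <= V S + (heavy S + missed S)%:E)%E.
  have [budget|budget] := leqP ((\sum_(i < m) (tnth S i == center)) * B) m.
    have := sup_test_ge rho0 rhoB r0 m0 nm budget; rewrite -/(V S) => hV.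
    rewrite -leeBlDr//; apply: le_trans hV; rewrite -EFinB lee_fin lerB//.
    by rewrite lerDr.
  apply: (@le_trans _ _ (heavy S + missed S)%:E); last by rewrite leeDr.
  rewrite lee_fin -[leLHS]addr0 lerD//.
  rewrite (_ : heavy S = \prod_(i < m) (2 ^+ ((tnth S i == center) * B) / 2)); last first.
    by apply: eq_bigr => i _; case: eqP => _; rewrite ?mul1n ?mul0n ?expr0 ?mul1r.
  rewrite big_split/= prodr_const card_ord -expr_sum -big_distrl/= exprVn.
  by rewrite ler_pdivlMr ?exprn_gt0// mul1r ler_eXn2l ?ltr1n// ltnW.
have Eheavy : Eprod (source p) (fun S => (heavy S)%:E) = ((p * (2 ^+ B / 2) + (1 - p) * 2^-1) ^+ m)%:E.
  rewrite (@Eprod_prod _ _ _ _ (fun _ x => if x == center then 2 ^+ B / 2 else 2^-1)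
    (fun=> p * (2 ^+ B / 2) + (1 - p) * 2^-1)) ?prodr_const ?card_ord//.
    by move=> _ x; case: ifP; rewrite ?divr_ge0 ?exprn_ge0 ?invr_ge0.
  by move=> _; rewrite esum_source_center// ?divr_ge0 ?exprn_ge0 ?invr_ge0.
have Ecov (phi : {ffun 'I_n -> 'I_m}) : injective phi ->
    Eprod (source p) (fun S => (cov phi S)%:E) = ((1 - p / r%:R) ^+ n)%:E.
  move=> phi_inj.
  (* The product is extended to all [m] positions, with factor 1 off the image of [phi], so that
     independence applies. *)
  transitivity (Eprod (source p) (fun S : m.-tuple X => (\prod_(i < m)
    (if i \in codom phi then 1 - (tnth S i == center)%:R / r%:R else 1))%:E)).
    apply: eq_esum => S _; congr (_ * _%:E)%E.
    exact: (@prod_inj_reindex _ _ _ _ (fun i => 1 - (tnth S i == center)%:R / r%:R)).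
  rewrite (@Eprod_prod _ _ _ _
    (fun i x => if i \in codom phi then 1 - (x == center)%:R / r%:R else 1)
    (fun i => if i \in codom phi then 1 - p / r%:R else 1)) => //.
  - rewrite -(@prod_inj_reindex _ _ _ _ (fun=> 1 - p / r%:R))//.
    by rewrite prodr_const card_ord.
  - by move=> i x; case: ifP.
  - move=> i; case: ifP => _; last first.
      by under eq_esum do rewrite mulr1; have [] := source_pmf p01 rs0.
    under eq_esum => x _.
      rewrite (_ : 1 - _ = if x == center then 1 - 1 / r%:R else 1); last first.
        by case: eqP => _ //; rewrite mul0r subr0.
      over.
    rewrite esum_source_center//; last exact: (factor_ge0 true).
    by congr _%:E; field; rewrite gt_eqF.
have Emissed : Eprod (source p) (fun S => (missed S)%:E) = (r%:R * (1 - p / r%:R) ^+ n)%:E.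
  rewrite EprodZl// ?invr_ge0 ?ler0n//; last first.
    by move=> S; rewrite sumr_ge0// => phi _; rewrite mulr_ge0.
  rewrite Eprod_sum//; last by move=> phi S; rewrite mulr_ge0.
  rewrite (eq_bigr (fun=> (r%:R * (1 - p / r%:R) ^+ n)%:E)); last first.
    move=> phi /injectiveP phi_inj; rewrite EprodZl//.
    by rewrite Ecov.
  by rewrite sumEFin -EFinM sumr_const -[X in _ * X]mulr_natl mulKf// gt_eqF.
rewrite EFinB leeBlDr// -(Eprod1 m (source_pmf p01 rs0)).
apply: (le_trans (le_Eprod q0 pointwise)).
rewrite EprodD//; last by move=> S; rewrite lee_fin addr_ge0.
rewrite leeD2l//.
under [X in Eprod _ X]eq_fun do rewrite EFinD.
rewrite EprodD// Eheavy Emissed -EFinD lee_fin lerD2r.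
(* The base is at most 3/4, since [p * 2 ^ B / 2] is at most 1/4 and [(1 - p) / 2] at most 1/2. *)
apply: lerXn2r; rewrite ?nnegrE; last by lra.
  by rewrite addr_ge0// mulr_ge0// ?divr_ge0 ?exprn_ge0// subr_ge0.
by rewrite divr_ge0.
Qed.

(** * The oblivious adversary *)

Lemma sum_delta_inj (I : finType) (u : I -> X) (q : X -> R) (P : pred I) (x : X) :
  injective u ->
  \sum_(i | P i) q (u i) * (x == u i)%:R = q x * [exists i, P i && (x == u i)]%:R.
Proof.
move=> u_inj; case: (boolP [exists i, _]) => [/existsP[i /andP[Pi /eqP ->]]|].
  rewrite (bigD1 i)//= eqxx big1 ?addr0// => k /andP[_ ki].
  by rewrite (inj_eq u_inj) eq_sym (negbTE ki) mulr0.
rewrite negb_exists => /forallP no; rewrite mulr0 big1// => i Pi.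
by have := no i; rewrite Pi/= => /negbTE ->; rewrite mulr0.
Qed.

Lemma esum_sum_delta (I : finType) (T : choiceType) (u : I -> T) (a : I -> R) (P : pred I) :
  (forall i, 0 <= a i) ->
  (\esum_(x in [set: T]) (\sum_(i | P i) a i * (x == u i)%:R)%:E = (\sum_(i | P i) a i)%:E)%E.
Proof.
move=> a0; under eq_esum do rewrite -sumEFin.
rewrite esum_sum; last by move=> x i _ _; rewrite lee_fin mulr_ge0.
by rewrite -sumEFin; apply: eq_bigr => i _; rewrite esum_delta.
Qed.

Lemma esum_avoid (I : finType) (u : I -> X) (q : X -> R) (P : pred I) :
  is_pmf q -> injective u ->
  (\esum_(x in [set: X]) (q x * (~~ [exists i, P i && (x == u i)])%:R)%:E
   = (1 - \sum_(i | P i) q (u i))%:E)%E.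
Proof.
move=> [q0 q1] u_inj; rewrite EFinB.
rewrite -[LHS](@addeK _ (\sum_(i | P i) q (u i))%:E)//; congr (_ - _)%E.
rewrite -(esum_sum_delta u P (a := fun i => q (u i)))//.
rewrite -esumD.
- rewrite -q1; apply: eq_esum => x _; rewrite -EFinD sum_delta_inj//.
  by case: [exists i, _]; rewrite /= ?mulr1 ?mulr0 ?addr0 ?add0r.
- by move=> x _; rewrite lee_fin mulr_ge0.
- by move=> x _; rewrite lee_fin sumr_ge0// => i _; rewrite mulr_ge0.
Qed.

Lemma sum_inj_le1 (I : finType) (u : I -> X) (q : X -> R) (P : pred I) :
  is_pmf q -> injective u -> \sum_(i | P i) q (u i) <= 1.
Proof.
move=> qpmf u_inj; rewrite -subr_ge0 -lee_fin -(esum_avoid _ qpmf u_inj).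
by apply: esum_ge0 => x _; rewrite lee_fin mulr_ge0//; case: qpmf.
Qed.

(* Since every change costs at least 1 + delta, at most a 1/(1+delta) fraction
   of the mass can move. *)
Lemma cell_mass_ge (rho : X -> X -> \bar R) (p delta : R) (q : X -> R)
    (A : {set 'I_r * 'I_s}) :
  is_cost rho -> 0 < delta ->
  (forall x y, x <> y -> ((1 + delta)%:E <= rho x y)%E) ->
  0 <= p <= 1 -> Crho_dist rho (source p) q ->
  delta / (1 + delta) - p - (1 - p) / (r * s)%:R * #|~: A|%:R
    <= \sum_(w in A) q (cell w).
Proof.
move=> [rho_ge0 rho0] d0 rho_gap p01 [[q0 q1] [pi [[[pi0 pi1] [pi_l pi_r]] cost]]].
have d1 : 0 < 1 + delta by lra.
have source_center : source p center = p.
  rewrite /source eqxx mulr1 big1 ?addr0// => w _.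
  by rewrite eq_sym cell_neq_center mulr0.
have source_cell w : source p (cell w) = (1 - p) / (r * s)%:R.
  rewrite /source cell_neq_center mulr0 add0r (bigD1 w)//= eqxx mulr1 big1 ?addr0//.
  by move=> v vw; rewrite (inj_eq cell_inj) eq_sym (negbTE vw) mulr0.
have pi_source x y : pi (x, y) <= source p x.
  rewrite -lee_fin -pi_l.
  by apply: (@esum_ge1 _ _ (fun y => (pi (x, y))%:E)) => z; rewrite lee_fin.
have pi_q x y : pi (x, y) <= q y.
  rewrite -lee_fin -pi_r.
  by apply: (@esum_ge1 _ _ (fun x => (pi (x, y))%:E)) => z; rewrite lee_fin.
pose D w := pi (cell w, cell w).
(* The diagonal of the coupling is dominated by the first marginal, so it lives on the centre and
   the cells. *)
have diag x : pi (x, x) <= pi (center, center) * ((x, x) == (center, center))%:R +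
    \sum_w D w * ((x, x) == (cell w, cell w))%:R.
  have [->|xc] := eqVneq x center.
    by rewrite eqxx mulr1 lerDl sumr_ge0// => w _; rewrite mulr_ge0// pi0.
  have [/existsP[w /eqP ->]|] := boolP [exists w, x == cell w].
    rewrite (bigD1 w)//= eqxx mulr1 -/(D w) addrCA lerDl addr_ge0 ?mulr_ge0 ?pi0//.
    by rewrite sumr_ge0// => v _; rewrite mulr_ge0// pi0.
  rewrite negb_exists => /forallP xw.
  apply: (@le_trans _ _ 0); last first.
    rewrite addr_ge0 ?mulr_ge0 ?pi0//.
    by rewrite sumr_ge0// => v _; rewrite mulr_ge0// pi0.
  apply: le_trans (pi_source x x) _; rewrite /source (negbTE xc) mulr0 add0r.
  by rewrite big1// => w _; rewrite (negbTE (xw w)) mulr0.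
(* Off the diagonal [pi] is at most [pi * rho / (1 + delta)], whose sum the cost constraint bounds
   by [1 / (1 + delta)]; the rest of the unit mass is diagonal. *)
have total : 1 <= pi (center, center) + \sum_w D w + (1 + delta)^-1.
  rewrite -lee_fin -pi1 !EFinD.
  rewrite -(esum_delta (center, center) (pi0 _)).
  rewrite -(esum_sum_delta (fun w => (cell w, cell w)) xpredT (a := D)); last first.
    by move=> w; exact: pi0.
  rewrite -esumD; last 2 first.
  - by move=> xy _; rewrite lee_fin mulr_ge0// pi0.
  - by move=> xy _; rewrite lee_fin sumr_ge0// => w _; rewrite mulr_ge0// pi0.
  apply: (@le_trans _ _ (\esum_(xy in [set: X * X])
     ((pi (center, center) * (xy == (center, center))%:R)%:E +
      (\sum_w D w * (xy == (cell w, cell w))%:R)%:E) +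
     ((1 + delta)^-1)%:E * \esum_(xy in [set: X * X]) ((pi xy)%:E * rho xy.1 xy.2))%E);
     last first.
    rewrite leeD2l// -[leRHS]mule1 lee_wpmul2l// lee_fin invr_ge0; exact: ltW.
  rewrite -esumZl ?invr_ge0 ?(ltW d1)//; last first.
    by move=> xy; rewrite mule_ge0// lee_fin pi0.
  rewrite -esumD; last 2 first.
  - move=> xy _; rewrite -EFinD lee_fin addr_ge0 ?mulr_ge0 ?pi0//.
    by rewrite sumr_ge0// => w _; rewrite mulr_ge0// pi0.
  - by move=> xy _; rewrite !mule_ge0// lee_fin ?invr_ge0 ?pi0// ltW.
  apply: le_esum => -[x y] _ /=.
  have [<-|xy] := eqVneq x y.
    by rewrite rho0 !mule0 adde0 -EFinD lee_fin diag.
  rewrite -[leLHS]add0e leeD//.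
    rewrite -EFinD lee_fin addr_ge0 ?mulr_ge0 ?pi0//.
    by rewrite sumr_ge0// => w _; rewrite mulr_ge0// pi0.
  rewrite muleCA -[leLHS]mule1 lee_wpmul2l ?lee_fin ?pi0//.
  rewrite -[leLHS](_ : ((1 + delta)^-1)%:E * (1 + delta)%:E = 1)%E; last first.
    by rewrite -EFinM mulVf ?gt_eqF.
  rewrite lee_wpmul2l ?lee_fin ?invr_ge0 ?(ltW d1)//.
  by apply: rho_gap; exact/eqP.
have ctr : pi (center, center) <= p by rewrite -[leRHS]source_center.
have outA : \sum_(w in ~: A) D w <= (1 - p) / (r * s)%:R * #|~: A|%:R.
  rewrite mulr_natr -sumr_const; apply: ler_sum => w _.
  by rewrite -(source_cell w); exact: pi_source.
have inA : \sum_(w in A) D w <= \sum_(w in A) q (cell w).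
  by apply: ler_sum => w _; exact: pi_q.
have split : \sum_w D w = \sum_(w in A) D w + \sum_(w in ~: A) D w.
  rewrite (bigID (mem A))/=; congr (_ + _).
  by apply: eq_bigl => w; rewrite inE.
have -> : delta / (1 + delta) = 1 - (1 + delta)^-1 by field; lra.
lra.
Qed.

(** Union bound over a witness whose cells have mass at least [tau] and over its position [i]; the
    other [n - 1] draws must avoid those cells. The exponentially many witnesses cost nothing,
    because their masses under [q] add up to at most 1: only the choice of [i] costs a factor
    [n]. *)
Lemma ObliviousMax_test_le (rho : X -> X -> \bar R) (p delta tau : R) (K n : nat) :
  is_cost rho -> 0 < delta ->
  (forall x y, x <> y -> ((1 + delta)%:E <= rho x y)%E) ->
  0 <= p <= 1 -> (0 < r)%N -> tau <= 1 ->
  r%:R * tau <= delta / (1 + delta) - p - (1 - p) / (r * s)%:R * (r * s - K)%:R ->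
  (ObliviousMax rho (@test K n) (source p) <= (n%:R * (1 - tau) ^+ n.-1)%:E)%E.
Proof.
move=> cost d0 rho_gap p01 r0 tau1 htau.
apply: ge_ereal_sup => _ [q qC <-].
have [[q0 q1] _] := qC.
have qpmf : is_pmf q by [].
have r0' : (0 < r%:R :> R) by rewrite ltr0n.
have /andP[p0 p1] := p01.
pose Q (jB : 'I_r * {set 'I_s}) := \sum_(a in jB.2) q (cell (jB.1, a)).
have cellj_inj j : injective (fun a => cell (j, a)) by move=> a a' /cell_inj[].
have Q1 jB : Q jB <= 1 by exact: (sum_inj_le1 _ qpmf (cellj_inj _)).
pose avoid (jB : 'I_r * {set 'I_s}) (x : X) := ~~ [exists a, (a \in jB.2) && (x == cell (jB.1, a))].
pose g (i : 'I_n) jB (k : 'I_n) (x : X) : R :=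
  if k == i then (x == witness jB.1 jB.2)%:R else (avoid jB x)%:R.
have g0 i jB k x : 0 <= g i jB k x by rewrite /g; case: ifP.
have pointwise (S : n.-tuple X) : (test K S)%:R <=
    \sum_(i < n) \sum_(jB | tau <= Q jB) \prod_(k < n) g i jB k (tnth S k).
  have P0 i jB : 0 <= \prod_(k < n) g i jB k (tnth S k) by apply: prodr_ge0.
  have [/existsP[A /and3P[KA /forallP Aw /forallP Ac]]|_] := boolP (test K S); last first.
    by apply: sumr_ge0 => i _; apply: sumr_ge0.
  (* Pigeonhole: if all rows of [A] were lighter than [tau], the mass of [A] would be below
     [r * tau], against [cell_mass_ge] and [htau]. *)
  have [j tauj] : exists j, tau <= Q (j, row A j).
    apply: contrapT => /forallNP noj.
    have : \sum_(j < r) Q (j, row A j) < r%:R * tau.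
      rewrite mulr_natl -[X in _ *+ X](card_ord r) -sumr_const.
      apply: ltr_sum; first by apply/hasP; exists (Ordinal r0) => //; rewrite mem_index_enum.
      by move=> j _; rewrite ltNge; apply/negP.
    rewrite ltNge => /negP; apply; apply: (le_trans htau).
    rewrite (_ : \sum_(j < r) _ = \sum_(w in A) q (cell w)); last first.
      rewrite /Q pair_big_dep/=; apply: eq_big => [[j a]|[j a] _] //=.
      by rewrite inE.
    apply: le_trans (cell_mass_ge A cost d0 rho_gap p01 qC).
    rewrite lerD2l lerN2 ler_wpM2l ?divr_ge0 ?subr_ge0// ler_nat.
    have := cardsC A; rewrite card_prod !card_ord; lia.
  have /tnthP[i Si] := Aw j.
  (* One term of the double sum already equals 1: the one for the witness of row [j] at its position
     in [S]. *)
  rewrite (bigD1 i)//= (bigD1 (j, row A j))//= -addrA.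
  rewrite (_ : \prod_(k < n) _ = 1); last first.
    rewrite big1// => k _; rewrite /g; case: eqP => [->|_]; first by rewrite -Si eqxx.
    rewrite /avoid/= (_ : [exists a, _] = false)//; apply/negbTE; rewrite negb_exists.
    apply/forallP => a; rewrite inE; apply/andP => -[ja /eqP Ska].
    by have := Ac (j, a); rewrite ja/= -Ska mem_tnth.
  by rewrite lerDl addr_ge0 ?sumr_ge0// => k _; rewrite sumr_ge0.
apply: (@le_trans _ _ (Eprod q (fun S : n.-tuple X => (\sum_(i < n) \sum_(jB | tau <= Q jB)
    \prod_(k < n) g i jB k (tnth S k))%:E))).
  by apply: le_Eprod => // S; rewrite lee_fin.
have P0 i jB (S : n.-tuple X) : 0 <= \prod_(k < n) g i jB k (tnth S k) by apply: prodr_ge0.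
rewrite Eprod_sum//; last by move=> i S; apply: sumr_ge0.
apply: (@le_trans _ _ (\sum_(i < n) ((1 - tau) ^+ n.-1)%:E)%E); last first.
  by rewrite sumEFin sumr_const card_ord mulr_natl.
apply: lee_sum => i _; rewrite Eprod_sum//.
have Eg jB : Eprod q (fun S : n.-tuple X => (\prod_(k < n) g i jB k (tnth S k))%:E) =
    (q (witness jB.1 jB.2) * (1 - Q jB) ^+ n.-1)%:E.
  rewrite (@Eprod_prod _ _ _ _ (g i jB)
    (fun k => if k == i then q (witness jB.1 jB.2) else 1 - Q jB))//.
    rewrite (bigD1 i)//= eqxx (eq_bigr (fun=> 1 - Q jB)); last by move=> k /negbTE ->.
    by rewrite prodr_const cardC1 card_ord.
  move=> k; rewrite /g; case: eqP => _; last exact: (esum_avoid _ qpmf (cellj_inj _)).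
  rewrite -[RHS](esum_delta (witness jB.1 jB.2))//; apply: eq_esum => x _.
  by case: eqP => [->|]; rewrite ?mulr0.
under eq_bigr do rewrite Eg.
rewrite sumEFin lee_fin.
have w_inj : injective (fun jB : 'I_r * {set 'I_s} => witness jB.1 jB.2).
  by move=> [j1 B1] [j2 B2] /e_inj[-> ->].
apply: (@le_trans _ _ (\sum_(jB | tau <= Q jB) q (witness jB.1 jB.2) * (1 - tau) ^+ n.-1)).
  apply: ler_sum => jB tauQ; rewrite ler_wpM2l// lerXn2r ?nnegrE ?subr_ge0 ?lerB//.
rewrite -mulr_suml ler_piMl ?exprn_ge0 ?subr_ge0//.
exact: (sum_inj_le1 _ qpmf w_inj).
Qed.

End Construction.

(** * Embedding the grid into a neighbourhood, and choosing its size *)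

Lemma embed_nbrs (R : realType) (X : choiceType) (rho : X -> X -> \bar R) (b : R)
    (T : finType) :
  is_cost rho -> 0 <= b -> (degb rho b < +oo)%E -> #|T|.+1%:R <= fine (degb rho b) ->
  exists e : option T -> X, injective e /\ forall w, (rho (e None) (e w) <= b%:E)%E.
Proof.
move=> [_ rho0] b0 dfin Td.
have Td' : (#|T|%:R%:E < degb rho b)%E.
  have T1 : (#|T|%:R < #|T|.+1%:R :> R) by rewrite ltr_nat.
  move: dfin Td; case: (degb rho b) => [d|//|] _ /= Td.
    by rewrite lte_fin (lt_le_trans T1).
  (* For empty [X], [degb] is [-oo] and its [fine] value is 0, against the hypothesis. *)
  by rewrite leNgt ltr0Sn in Td.
have [_ [k [x [L [Luniq Lk Lb]]] <-]] := ereal_sup_gt Td'.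
rewrite lte_fin ltr_nat => kT.
(* The point [x] serves as the centre and may occur among its own neighbours; the strict inequality
   [kT] pays for its removal. *)
pose L' := rem x L.
have sizeL' : (#|T| <= size L')%N.
  rewrite /L'; have [xL|/rem_id ->] := boolP (x \in L); last by rewrite Lk ltnW.
  by rewrite size_rem// Lk; lia.
have rankL' (t : T) : (enum_rank t < size L')%N by apply: leq_trans sizeL'.
pose e (w : option T) := if w is Some t then nth x L' (enum_rank t) else x.
have eL t : e (Some t) \in L' by rewrite mem_nth.
exists e; split.
  have xL' : x \notin L' by rewrite mem_rem_uniqF.
  move=> [t|] [u|]//.
  - rewrite /e => /eqP; rewrite nth_uniq ?rem_uniq// => /eqP tu.
    by rewrite (enum_rank_inj (ord_inj tu)).
  - by move=> tx; move: xL'; rewrite -[x]tx eL.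
  - by move=> tx; move: xL'; rewrite [x]tx eL.
move=> [t|]; last by rewrite rho0 lee_fin.
by apply: Lb; apply: mem_rem (eL t).
Qed.

(** Induction from [8 * 3 ^ 8 <= 4 ^ 8]; the induction step only uses [3 <= n]. *)
Lemma expr34_le (R : realType) (n : nat) : (8 <= n)%N -> (3 / 4 : R) ^+ n <= n%:R^-1.
Proof.
move=> n8; have nX : (n * 3 ^ n <= 4 ^ n)%N.
  rewrite -(subnK n8) addnC; elim: (n - 8)%N => [//|k IH].
  rewrite addnS (expnS 3 (8 + k)) (expnS 4 (8 + k)) mulnCA mulSn.
  have : (3 * 3 ^ (8 + k) <= (8 + k) * 3 ^ (8 + k))%N by rewrite leq_mul2r; lia.
  move: IH; move: ((8 + k) * 3 ^ (8 + k))%N (3 ^ (8 + k))%N (4 ^ (8 + k))%N => u v c.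
  lia.
have n0 : (0 < n%:R :> R) by rewrite ltr0n; lia.
rewrite expr_div_n -[leRHS]mul1r ler_pdivrMr ?exprn_gt0// mul1r mulrC.
rewrite ler_pdivlMr// mulrC.
by rewrite -!natrX -natrM ler_nat.
Qed.

Lemma expr1B_le (R : realType) (x : R) (n : nat) : x <= 1 ->
  (1 - x) ^+ n <= expR (- (x * n%:R)).
Proof.
move=> x1; rewrite -mulNr expRM_natr; apply: lerXn2r.
- by rewrite nnegrE subr_ge0.
- by rewrite nnegrE expR_ge0.
- exact: expR_ge1Dx.
Qed.

Lemma expRN2ln (R : realType) (x y : R) : 0 < y -> 2 * ln y <= x -> expR (- x) <= y ^- 2.
Proof.
move=> y0 yx; apply: (@le_trans _ _ (expR (- (2 * ln y)))).
  by rewrite ler_expR lerN2.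
by rewrite expRN expRM_natl lnK.
Qed.

(** With [q] the square root of [n], [2 * ln n = 4 * ln q < 4 * q <= p * q ^ 2] as soon as
    [q >= 4 / p]. *)
Lemma ln_nat_small (R : realType) (p : R) : 0 < p ->
  exists n0 : nat, forall n : nat, (n0 <= n)%N ->
    [/\ (8 <= n)%N, 1 <= ln (n%:R : R) & 2 * ln (n%:R : R) <= p * n%:R].
Proof.
have archi (x : R) : exists N : nat, x <= N%:R.
  by exists (Num.trunc x).+1; rewrite ltW// truncnS_gt.
move=> p0; have [N1 hN1] := archi (expR 1); have [N2 hN2] := archi ((4 / p) ^+ 2).
exists (8 + N1 + N2)%N => n hn.
have n0 : (0 < n%:R :> R) by rewrite ltr0n; lia.
split; first by lia.
  rewrite -[X in X <= _](@expRK R) ler_ln ?posrE ?expR_gt0//.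
  by apply: (le_trans hN1); rewrite ler_nat; lia.
have n4 : (4 / p) ^+ 2 <= n%:R by apply: (le_trans hN2); rewrite ler_nat; lia.
have q0 : 0 < Num.sqrt (n%:R : R) by rewrite sqrtr_gt0.
have q2 : Num.sqrt (n%:R : R) ^+ 2 = n%:R by rewrite sqr_sqrtr// ltW.
have q4 : 4 <= p * Num.sqrt (n%:R : R).
  rewrite mulrC -ler_pdivrMr//.
  by rewrite -(@ler_pXn2r _ 2) ?q2 ?nnegrE ?divr_ge0 ?(ltW q0) ?(ltW p0).
have lnq : ln (n%:R : R) = 2 * ln (Num.sqrt (n%:R : R)).
  by rewrite -[in LHS]q2 lnXn// mulr_natl.
rewrite lnq -[X in p * X]q2; have := ln_sublinear q0; nra.
Qed.

(** The centre, the cells and the witnesses each number at most [r * 2 ^ s]. *)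
Lemma grid_card_le (r s : nat) : (0 < r)%N ->
  ((r * s + r * 2 ^ s).+1 <= r * 2 ^ s.+2)%N.
Proof.
move=> r0; rewrite -(addn2 s) expnD mulnA.
have : (r * s <= r * 2 ^ s)%N by rewrite leq_mul2l ltnW ?orbT// ltn_expl.
have : (0 < r * 2 ^ s)%N by rewrite muln_gt0 r0 expn_gt0.
move: (r * s)%N (r * 2 ^ s)%N => u v v0 uv; rewrite -[(2 ^ 2)%N]/4%N.
lia.
Qed.

(** The number of rows is about [p n / (2 ln n)], as large as covering every row by drawn centres
    permits. Then [s], about [2 m / (eta r)], makes [m] cells at most a fraction [eta / 2] of the
    grid. *)
Lemma grid_size (R : realType) (eta p : R) (n m : nat) :
  0 < eta -> 0 < p -> p <= 1 -> (n < m)%N ->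
  1 <= ln (n%:R : R) -> 2 * ln (n%:R : R) <= p * n%:R ->
  exists r s : nat, [/\ (0 < r * s)%N, r%:R * (2 * ln (n%:R : R)) <= p * n%:R,
    2 * m%:R <= eta * (r * s)%:R &
    ln (r * s + r * 2 ^ s).+1%:R <= (4 + 8 / (eta * p)) * (m%:R * ln (n%:R : R) / n%:R)].
Proof.
move=> eta0 p0 p1 nm; set l := ln _ => l1 lp.
have n0 : (0 < n%:R :> R).
  by rewrite -(pmulr_rgt0 _ p0) (lt_le_trans _ lp)//; lra.
have nm' : n%:R < m%:R :> R by rewrite ltr_nat.
have m0 : 0 < m%:R :> R by lra.
have l0 : 0 < l by lra.
pose x := p * n%:R / (2 * l).
have x1 : 1 <= x by rewrite ler_pdivlMr ?mul1r//; lra.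
pose r := Num.trunc x.
have r0 : (0 < r)%N by rewrite truncn_gt0.
have rx : r%:R <= x by rewrite truncn_le; lra.
have xr : x < r.+1%:R := truncnS_gt x.
have r1 : 1 <= r%:R :> R by rewrite ler1n.
have xr2 : x <= 2 * r%:R by move: xr; rewrite -addn1 natrD; lra.
have r0' : 0 < r%:R :> R by lra.
have er0 : 0 < eta * r%:R by exact: mulr_gt0.
have ep0 : 0 < eta * p by exact: mulr_gt0.
pose y := 2 * m%:R / (eta * r%:R).
have y0 : 0 <= y by rewrite divr_ge0// ?(ltW er0)// mulr_ge0// ltW.
have [s s0 [ys sy]] : exists2 s : nat, (0 < s)%N & y < s%:R /\ s%:R <= y + 1.
  exists (Num.trunc y).+1 => //; split; first exact: truncnS_gt.
  by rewrite -addn1 natrD lerD2r truncn_le.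
have xE : x * (2 * l) = p * n%:R by rewrite /x divfK// gt_eqF// mulr_gt0.
have yE : y * (eta * r%:R) = 2 * m%:R by rewrite /y divfK// gt_eqF.
exists r, s; split.
- by rewrite muln_gt0 r0.
- by rewrite -xE ler_pM2r//; lra.
- by rewrite natrM mulrA -yE mulrC ler_pM2l// ltW.
have rn : r%:R <= n%:R :> R.
  have : r%:R * 1 <= r%:R * (2 * l) by rewrite ler_pM2l//; lra.
  have : r%:R * (2 * l) <= x * (2 * l) by rewrite ler_pM2r//; lra.
  rewrite xE; nra.
have Mle := grid_card_le s r0.
apply: (@le_trans _ _ (ln (r * 2 ^ s.+2)%:R)).
  by rewrite ler_ln ?posrE ?ltr0n ?ler_nat// muln_gt0 r0 expn_gt0.
rewrite natrM natrX lnM ?posrE ?exprn_gt0// lnXn//.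
have ln2 : ln (2 : R) <= 1 by have := @le_ln1Dx R 1; apply; lra.
have lnr : ln (r%:R : R) <= l by rewrite ler_ln ?posrE.
have s2 : ln (2 : R) *+ s.+2 <= s%:R + 2.
  by rewrite -(natrD _ s 2) addn2 -[leLHS]mulr_natl ler_piMr.
pose z := m%:R * l / n%:R.
have lz : l <= z by rewrite /z ler_pdivlMr// mulrC ler_pM2r// ltW.
(* From [x <= 2 r]: [y = 2 m / (eta r) <= 4 m / (eta x) = 8 m l / (eta p n)]. *)
have yz : y <= 8 / (eta * p) * z.
  have zE : z * n%:R = m%:R * l by rewrite /z divfK// gt_eqF.
  rewrite mulrAC ler_pdivlMr// -(ler_pM2r n0) -(ler_pM2r r0').
  have -> : y * (eta * p) * n%:R * r%:R = (y * (eta * r%:R)) * (p * n%:R) by ring.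
  have -> : 8 * z * n%:R * r%:R = 8 * (z * n%:R) * r%:R by ring.
  rewrite yE zE -xE.
  have -> : 2 * m%:R * (x * (2 * l)) = 4 * (m%:R * l) * x by ring.
  have -> : 8 * (m%:R * l) * r%:R = 4 * (m%:R * l) * (2 * r%:R) by ring.
  by rewrite ler_pM2l// !mulr_gt0.
(* The logarithm is at most [l + s + 2 <= l + y + 3], and [1 <= l <= z] gives [l + 3 <= 4 z]. *)
rewrite -/z mulrDl; lra.
Qed.

Lemma leq_double_pred (n : nat) : (1 < n)%N -> (n <= n.-1 * 2)%N.
Proof. lia. Qed.

(** * Choice of constants and final estimates *)

Theorem mainTheorem16 (R : realType) :
  exists C : R,
  forall b delta : R, 0 < b -> 0 < delta ->
  exists c : R, 0 < c /\
  exists n0 : nat,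
  forall n : nat, (n0 <= n)%N ->
  forall (X : countType) (rho : X -> X -> \bar R),
    is_cost rho ->
    (forall x y, x <> y -> ((1 + delta)%:E <= rho x y)%E) ->
    (degb rho b < +oo)%E ->
  forall m : nat, (n < m)%N ->
    m%:R <= c * n%:R / (ln (n%:R : R)) ^+ 2 * ln (fine (degb rho b)) ->
  exists (f : n.-tuple X -> bool) (p : X -> R),
    is_pmf p /\
    (((1 - C / n%:R)%:E <= AdaptiveMax_sub rho m f p)%E /\
     (ObliviousMax rho f p <= (C / n%:R)%:E)%E).
Proof.
exists 2 => b delta b0 d0.
have d1 : 0 < 1 + delta by lra.
(* Mass at least [2 * eta] stays in place. The centre and the unclaimed cells take at most [eta / 4]
   and [eta / 2] of it, which leaves more than [eta / 2] on the claimed cells. *)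
pose eta := delta / (1 + delta) / 2.
have eta0 : 0 < eta by rewrite !divr_gt0.
have eta2 : delta / (1 + delta) = 2 * eta by rewrite /eta; field; rewrite gt_eqF.
have eta1 : eta < 2^-1.
  by rewrite /eta ltr_pdivrMr// mulVf// ltr_pdivrMr// mul1r; lra.
have [B bB B2] : exists2 B : nat, b <= B%:R & 4 <= 2 ^+ B.+1 :> R.
  exists (Num.trunc b).+1; first by rewrite ltW// truncnS_gt.
  by rewrite -natrX ler_nat -[4%N]/(2 ^ 2)%N leq_exp2l.
have B0 : 0 < 2 ^+ B.+1 :> R by rewrite exprn_gt0.
(* The exponent [B.+1] makes [p * 2 ^ B] equal to [eta / 2], as the Markov bound requires, and with
   [B2] it gives [4 * p <= eta]. *)
pose p := eta / 2 ^+ B.+1.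
have pE : p * 2 ^+ B.+1 = eta by rewrite /p divfK// gt_eqF.
have p0 : 0 < p by rewrite divr_gt0.
have p4 : 4 * p <= eta by rewrite -pE mulrC ler_pM2l.
have p01 : 0 <= p <= 1 by apply/andP; split; lra.
have [n0 hn0] := ln_nat_small p0.
have ep0 : 0 < eta * p by exact: mulr_gt0.
have K0 : 0 < 4 + 8 / (eta * p) by rewrite addr_gt0// divr_gt0.
exists (4 + 8 / (eta * p))^-1; split; first by rewrite invr_gt0.
exists n0 => n /hn0[n8 l1 lp] X rho cost rho_gap dfin m nm hm.
have p1 : p <= 1 by lra.
have [r [s [rs0 rn rsm Mle]]] := grid_size eta0 p0 p1 nm l1 lp.
have n0' : 0 < n%:R :> R by rewrite ltr0n (leq_trans _ n8).
have m0 : 0 < m%:R :> R by rewrite ltr0n (leq_ltn_trans _ nm).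
move: l1 lp rn Mle hm; set l := ln n%:R => l1 lp rn Mle hm.
have l0 : 0 < l by lra.
set d := fine (degb rho b) in hm.
(* The grid needs only one logarithm; the second factor [l] is at least 1 and is dropped in
   [lnd]. *)
have hm' : (4 + 8 / (eta * p)) * (m%:R * l / n%:R) * l <= ln d.
  move: hm; set K := 4 + _ in K0 *.
  have -> : K^-1 * n%:R / l ^+ 2 * ln d = ln d * n%:R / (K * l ^+ 2).
    by field; rewrite !gt_eqF.
  rewrite ler_pdivlMr ?mulr_gt0 ?exprn_gt0// -ler_pdivrMr//.
  by congr (_ <= _); field; rewrite gt_eqF.
have lnM0 : 0 < ln (r * s + r * 2 ^ s).+1%:R :> R.
  by rewrite ln_gt0// ltr1n ltnS addn_gt0 rs0.
have lnd : ln (r * s + r * 2 ^ s).+1%:R <= ln d.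
  apply: le_trans hm'; apply: (le_trans Mle); rewrite ler_peMr//.
  by rewrite !mulr_ge0 ?invr_ge0 ?(ltW K0) ?(ltW l0).
(* [ln] takes the default value 0 at nonpositive reals, so a positive [ln d] forces [d > 0]. *)
have dgt0 : 0 < d.
  rewrite ltNge; apply/negP => d_le0.
  by have := lt_le_trans lnM0 lnd; rewrite ltNge ln_le0//; lra.
have Md : #|{: 'I_r * 'I_s + 'I_r * {set 'I_s}}|.+1%:R <= d.
  rewrite card_sum !card_prod !card_ord.
  have -> : #|{set 'I_s}| = (2 ^ s)%N.
    by rewrite -cardsT -powersetT card_powerset cardsT card_ord.
  by move: lnd; rewrite ler_ln ?posrE.
have [e [e_inj eb]] := embed_nbrs cost (ltW b0) dfin Md.
exists (@test X r s e (r * s - m) n), (@source R X r s e p).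
have r0 : (0 < r)%N by move: rs0; rewrite muln_gt0 => /andP[].
have r0' : 0 < r%:R :> R by rewrite ltr0n.
have rs0' : 0 < (r * s)%:R :> R by rewrite ltr0n.
have r1 : 1 <= r%:R :> R by rewrite ler1n.
split; first exact: source_pmf.
split.
- apply: le_trans (AdaptiveMax_test_ge (B := B) e_inj cost _ p01 _ rs0 _ _); last 4 first.
  + by move=> w; apply: le_trans (eb w) _; rewrite lee_fin.
  + rewrite -(ler_pM2r (_ : 0 < 2)) ?mulVf// -mulrA -exprSr pE; lra.
  + exact: leq_ltn_trans nm.
  + exact: ltnW.
  rewrite lee_fin lerD2l lerN2.
  (* One [1 / n] pays for an exceeded budget, the other for missed rows: [r <= n] and [(1 - p / r) ^
     n <= exp (- p n / r) <= n ^ -2]. *)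
  have -> : 2 / n%:R = n%:R^-1 + n%:R * n%:R ^- 2 :> R by field; rewrite gt_eqF.
  apply: lerD.
    apply: le_trans (expr34_le R n8).
    by apply: ler_wiXn2l; [lra|lra|exact: ltnW].
  apply: ler_pM => //.
  + by rewrite exprn_ge0// subr_ge0 ler_pdivrMr// mul1r; lra.
  + have : r%:R * 1 <= r%:R * (2 * l) by rewrite ler_pM2l//; lra.
    nra.
  + apply: (le_trans (expr1B_le _ _)); first by rewrite ler_pdivrMr// mul1r; lra.
    by apply: expRN2ln => //; rewrite mulrAC ler_pdivlMr// mulrC.
(* Since [r <= p n / (2 l)] and [4 p <= eta], this [tau] is at least [4 l / n]. *)
- pose tau := eta / (2 * r%:R).
  have tau1 : tau <= 1 by rewrite ler_pdivrMr ?mul1r ?mulr_gt0//; lra.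
  (* Subtraction is truncated: [r s - (r s - m)] equals [m] only because [m <= r s]. *)
  have mrs : (m <= r * s)%N.
    rewrite -(ler_nat R); nra.
  have htau : r%:R * tau <= delta / (1 + delta) - p -
      (1 - p) / (r * s)%:R * (r * s - (r * s - m))%:R.
    rewrite subKn// (_ : r%:R * tau = eta / 2); last by rewrite /tau; field; rewrite gt_eqF.
    have : (1 - p) / (r * s)%:R * m%:R <= eta / 2.
      rewrite mulrAC ler_pdivrMr//.
      have : (1 - p) * m%:R <= 1 * m%:R by rewrite ler_pM2r//; lra.
      lra.
    rewrite eta2; lra.
  apply: le_trans (ObliviousMax_test_le e_inj n cost d0 rho_gap p01 r0 tau1 htau) _.
  rewrite lee_fin.
  have -> : 2 / n%:R = n%:R * (2 * n%:R ^- 2) :> R by field; rewrite gt_eqF.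
  rewrite ler_pM2l//.
  apply: (@le_trans _ _ (n%:R ^- 2)); last first.
    by rewrite ler_peMl ?ler1n// invr_ge0 exprn_ge0.
  apply: (le_trans (expr1B_le _ tau1)); apply: expRN2ln => //.
  rewrite -/l /tau mulrAC ler_pdivlMr ?mulr_gt0//.
  (* One draw is spent on the witness; [n - 1 >= n / 2] still keeps [tau * (n - 1)] at least
     [2 l]. *)
  have n1 : n%:R / 2 <= n.-1%:R :> R.
    rewrite ler_pdivrMr// -(natrM _ _ 2) ler_nat leq_double_pred//; exact: leq_trans n8.
  apply: (@le_trans _ _ (2 * (p * n%:R))); first by lra.
  apply: (@le_trans _ _ (eta * (n%:R / 2))); last by rewrite ler_pM2l.
  rewrite mulrA; have : 4 * p * n%:R <= eta * n%:R by rewrite ler_pM2r.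
  lra.
Qed.
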